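(* Suppose the parameters $(A_0,\ldots,A_{k-1},q_0,\ldots,q_{k-1},q,\lambda)$ of $R$ are admissible. Then the following relations hold on $V$: $$\sum_{l=0}^{k}q_l\bar Y^l=0,$$ $$\bar X\bar W=\bar W\bar X=1,$$ $$\bar X\bar E=\lambda\bar E=\bar E\bar X,$$ $$\bar Y\bar X\bar Y\bar X=\bar X\bar Y\bar X\bar Y,$$ $$\bar E\bar Y^m\bar E=A_m\bar E\quad\text{for all } 0\le m\le k-1,$$ $$\bar E\bar Y\bar X\bar Y=\bar Y\bar X\bar Y\bar E=\lambda^{-1}\bar E.$$ Furthermore $V$ is a $\mathscr{B}_2^k(R)$-module, where the actions of $Y$, $X$, $X^{-1}$ and $e$ on $V$ are given by the maps $\bar Y$, $\bar X$, $\bar W$ and $\bar E$, respectively.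
   Context: Parameters. Let $k\ge 1$ be a natural number. Let $R$ be a commutative ring containing units $q_0,q,\lambda$ and further elements $A_0,\ldots,A_{k-1},q_1,\ldots,q_{k-1}$ such that $\lambda-\lambda^{-1}=\delta(1-A_0)$, where $\delta:=q-q^{-1}$. Assume $\delta$ is not a zero divisor in $R$. Put $q_k:=-1$. The algebra. $\mathscr{B}_2^k(R)$ is the unital associative $R$-algebra generated by $Y^{\pm1},X^{\pm1},e$ subject to: $Y^k=\sum_{i=0}^{k-1}q_iY^i$; $X-X^{-1}=\delta(1-e)$; $XYXY=YXYX$; $Xe=\lambda e=eX$; $YXYe=\lambda^{-1}e=eYXY$; $eY^me=A_me$ for $0\le m\le k-1$. Admissibility. Write $k=2z-\epsilon$ with $z=\lceil k/2\rceil$, so $\epsilon=0$ if $k$ is even and $\epsilon=1$ if $k$ is odd. Set $$\beta=q_0\lambda-q_0^{-1}\lambda^{-1}+(1-\epsilon)\delta,$$ and for $1\le l\le k-1$, $$h_l=\lambda^{-1}(q_l+q_0^{-1}q_{k-l})+\delta\left[\sum_{r=1}^{k-l}q_{r+l}A_r-\sum_{i=\max(l+1,z)}^{\lfloor (l+k)/2\rfloor}q_{2i-l}+\sum_{i=\lceil l/2\rceil}^{\min(l,z-1)}q_{2i-l}\right]$$ (empty sums are $0$). The parameters are called admissible if $\lambda-\lambda^{-1}=\delta(1-A_0)$ and $h_1=\cdots=h_{k-1}=\beta=0$. The module $V$. $V$ is the free $R$-module with basis $v_0,\ldots,v_{k-1}$. The linear map $\bar Y:V\to V$ is given by $\bar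 Yv_i=v_{i+1}$ for $0\le i\le k-2$ and $\bar Yv_{k-1}=\sum_{i=0}^{k-1}q_iv_i$; it is invertible since $q_0$ is a unit. The linear maps $\bar X,\bar E:V\to V$ are given on the basis by $\bar Xv_0=\lambda v_0$, $\bar Xv_1=\lambda^{-1}\bar Y^{-1}v_0$ (if $k\ge 2$), $\bar Xv_i=\bar Y^{-1}\bar Xv_{i-1}-\delta v_{i-2}+\delta A_{i-1}\bar Y^{-1}v_0$ for $2\le i\le k-1$, and $\bar Ev_i=A_iv_0$ for $0\le i\le k-1$. Put $\bar W:=\bar X-\delta+\delta\bar E$. *)

(* Defs.v *)
From HB Require Import structures.
From mathcomp Require Import all_boot all_algebra.
From mathcomp Require Import boolp.
From mathcomp.multinomials Require Import monalg.

Set Implicit Arguments.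
Unset Strict Implicit.
Unset Printing Implicit Defensive.

Import GRing.Theory.

Local Open Scope ring_scope.
Local Open Scope quotient_scope.

(* Associative unital algebras over R given by generators G and relations:
   the quotient of the free algebra {malg R[{fmonom G}]} by the two-sided ideal
   generated by the differences x - y for rel x y.  Nothing guarantees 1 != 0 in
   the quotient, so it is a pzRingType and an lmodType rather than an algType,
   together with the two compatibility lemmas palg_scalerAl, palg_scalerAr. *)
Section PresentedAlgebra.
Variables (R : comNzRingType) (G : choiceType).
Local Notation F := {malg R[{fmonom G}]}.
Variable rel : F -> F -> Prop.

Inductive in_rel_ideal : F -> Prop :=
| rel_ideal0 : in_rel_ideal 0
| rel_idealD x y : in_rel_ideal x -> in_rel_ideal y -> in_rel_ideal (x + y)
| rel_ideal_gen a b x y : rel x y -> in_rel_ideal (a * (x - y) * b).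

Definition rel_ideal : pred F := fun x => `[< in_rel_ideal x >].

Lemma rel_idealP x : reflect (in_rel_ideal x) (x \in rel_ideal).
Proof. exact: asboolP. Qed.

Lemma rel_idealMl a x : in_rel_ideal x -> in_rel_ideal (a * x).
Proof.
elim=> [|x1 x2 _ h1 _ h2|c d x1 x2 h].
- by rewrite mulr0; apply: rel_ideal0.
- by rewrite mulrDr; apply: rel_idealD.
- by rewrite !mulrA; apply: rel_ideal_gen.
Qed.

Lemma rel_idealMr a x : in_rel_ideal x -> in_rel_ideal (x * a).
Proof.
elim=> [|x1 x2 _ h1 _ h2|c d x1 x2 h].
- by rewrite mul0r; apply: rel_ideal0.
- by rewrite mulrDl; apply: rel_idealD.
- by rewrite -mulrA; apply: rel_ideal_gen.
Qed.

Fact rel_ideal_zmod_closed : zmod_closed rel_ideal.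
Proof.
split=> [|x y /rel_idealP hx /rel_idealP hy]; apply/rel_idealP.
  exact: rel_ideal0.
by apply: rel_idealD hx _; rewrite -mulN1r; apply: rel_idealMl.
Qed.

HB.instance Definition _ := GRing.isZmodClosed.Build F rel_ideal
  rel_ideal_zmod_closed.

Definition rel_ideal_zmod : zmodClosed F := GRing.ZmodClosed.clone F rel_ideal _.

Definition palg : Type := Quotient.quot rel_ideal_zmod.
HB.instance Definition _ := Choice.on palg.
HB.instance Definition _ := GRing.Zmodule.on palg.

Definition palg_pi (x : F) : palg := \pi_(Quotient.quot rel_ideal_zmod) x.

Lemma palg_eqP x y : reflect (palg_pi x = palg_pi y) (x - y \in rel_ideal).
Proof. by rewrite (Quotient.idealrBE rel_ideal_zmod); apply: eqP. Qed.

Lemma palg_piK (u : palg) : palg_pi (repr u) = u.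
Proof. exact: reprK. Qed.

Lemma palg_piD : {morph palg_pi : x y / x + y}.
Proof. by move=> x y; rewrite /palg_pi !piE. Qed.

Definition palg_one : palg := palg_pi 1.
Definition palg_mul (u v : palg) : palg := palg_pi (repr u * repr v).
Definition palg_scale (c : R) (u : palg) : palg := palg_pi (c *: repr u).

Lemma palg_piM x y : palg_pi (x * y) = palg_mul (palg_pi x) (palg_pi y).
Proof.
rewrite /palg_mul; apply/palg_eqP.
set x' := repr _; set y' := repr _.
have hx : in_rel_ideal (x - x').
  by apply/rel_idealP/palg_eqP; rewrite palg_piK.
have hy : in_rel_ideal (y - y').
  by apply/rel_idealP/palg_eqP; rewrite palg_piK.
have -> : x * y - x' * y' = (x - x') * y + x' * (y - y').
  by rewrite mulrBl mulrBr addrA subrK.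
by apply/rel_idealP/rel_idealD; [apply: rel_idealMr|apply: rel_idealMl].
Qed.

Lemma palg_piZ c x : palg_pi (c *: x) = palg_scale c (palg_pi x).
Proof.
apply/palg_eqP/rel_idealP; rewrite -scalerBr -mul_malgC; apply: rel_idealMl.
by apply/rel_idealP/palg_eqP; rewrite palg_piK.
Qed.

Fact palg_mulA : associative palg_mul.
Proof.
move=> u v w; rewrite -[u]palg_piK -[v]palg_piK -[w]palg_piK.
by rewrite -!palg_piM mulrA.
Qed.

Fact palg_mul1 : left_id palg_one palg_mul.
Proof. by move=> u; rewrite -[u]palg_piK -palg_piM mul1r. Qed.

Fact palg_mulr1 : right_id palg_one palg_mul.
Proof. by move=> u; rewrite -[u]palg_piK -palg_piM mulr1. Qed.

Fact palg_mulDl : left_distributive palg_mul +%R.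
Proof.
move=> u v w; rewrite -[u]palg_piK -[v]palg_piK -[w]palg_piK.
by rewrite -palg_piD -!palg_piM mulrDl palg_piD.
Qed.

Fact palg_mulDr : right_distributive palg_mul +%R.
Proof.
move=> u v w; rewrite -[u]palg_piK -[v]palg_piK -[w]palg_piK.
by rewrite -palg_piD -!palg_piM mulrDr palg_piD.
Qed.

HB.instance Definition _ := GRing.Zmodule_isPzRing.Build palg
  palg_mulA palg_mul1 palg_mulr1 palg_mulDl palg_mulDr.

Fact palg_scaleA a b u : palg_scale a (palg_scale b u) = palg_scale (a * b) u.
Proof. by rewrite -[u]palg_piK -!palg_piZ scalerA. Qed.

Fact palg_scale1 : left_id 1 palg_scale.
Proof. by move=> u; rewrite -[u]palg_piK -palg_piZ scale1r. Qed.

Fact palg_scaleDr : right_distributive palg_scale +%R.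
Proof.
move=> a u v; rewrite -[u]palg_piK -[v]palg_piK.
by rewrite -palg_piD -!palg_piZ scalerDr palg_piD.
Qed.

Fact palg_scaleDl u : {morph palg_scale^~ u : a b / a + b}.
Proof. by move=> a b; rewrite -[u]palg_piK -!palg_piZ scalerDl palg_piD. Qed.

HB.instance Definition _ := GRing.Zmodule_isLmodule.Build R palg
  palg_scaleA palg_scale1 palg_scaleDr palg_scaleDl.

Lemma palg_scalerAl (a : R) (u v : palg) : a *: (u * v) = (a *: u) * v.
Proof.
rewrite -[u]palg_piK -[v]palg_piK -[LHS]/(palg_scale _ (palg_mul _ _)).
by rewrite -palg_piM -palg_piZ scalerAl palg_piM palg_piZ.
Qed.

Lemma malgC_comm (a : R) (x : F) : a%:MP * x = x * a%:MP.
Proof.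
rewrite [x]monalgE mulr_sumr mulr_suml; apply: eq_bigr => m _.
by rewrite !malgM_def !fgmulUU mul1m mulm1 mulrC.
Qed.

Lemma palg_scalerAr (a : R) (u v : palg) : a *: (u * v) = u * (a *: v).
Proof.
rewrite -[u]palg_piK -[v]palg_piK -[LHS]/(palg_scale _ (palg_mul _ _)).
rewrite -[RHS]/(palg_mul _ (palg_scale _ _)).
by rewrite -palg_piZ -!palg_piM -palg_piZ -!mul_malgC !mulrA malgC_comm.
Qed.

Lemma palg_rel x y : rel x y -> palg_pi x = palg_pi y.
Proof.
move=> hxy; apply/palg_eqP/rel_idealP.
by rewrite -[x - y]mul1r -[_ * _]mulr1; apply: rel_ideal_gen.
Qed.

Definition palg_gen (g : G) : palg := palg_pi << fmu g >>.

End PresentedAlgebra.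

(* The family qs supplies q_0, ..., q_(k-1), and q_k is -1; similarly only
   A 0, ..., A k.-1 are used. *)
Definition qcoef (R : comUnitRingType) (k : nat) (qs : nat -> R) (i : nat) : R :=
  if i == k then -1 else qs i.

Variant bmw_gen := genY | genYi | genX | genXi | genE.

Definition bmw_gen_code (g : bmw_gen) : 'I_5 :=
  match g with
  | genY => inord 0 | genYi => inord 1 | genX => inord 2 | genXi => inord 3
  | genE => inord 4
  end.

Definition bmw_gen_decode (i : 'I_5) : bmw_gen :=
  nth genE [:: genY; genYi; genX; genXi] i.

Lemma bmw_gen_codeK : cancel bmw_gen_code bmw_gen_decode.
Proof. by case; rewrite /bmw_gen_decode /= inordK. Qed.

HB.instance Definition _ := Choice.copy bmw_gen (can_type bmw_gen_codeK).

(* The axioms of GRing.Zmodule_isLmodule, as a predicate on the action. *)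
Record is_left_module (B : pzRingType) (V : zmodType) (act : B -> V -> V) :
    Prop := IsLeftModule {
  is_left_module_scaleA : forall b c v, act b (act c v) = act (b * c) v;
  is_left_module_scale1 : forall v, act 1 v = v;
  is_left_module_scaleDr : forall b u v, act b (u + v) = act b u + act b v;
  is_left_module_scaleDl : forall v b c, act (b + c) v = act b v + act c v
}.

Section BMW.
Variables (R : comUnitRingType) (k : nat) (A qs : nat -> R) (q lam : R).
Local Notation F := {malg R[{fmonom bmw_gen}]}.
Local Notation delta := (q - q^-1).

Local Notation fY := (<< fmu genY >> : F).
Local Notation fYi := (<< fmu genYi >> : F).
Local Notation fX := (<< fmu genX >> : F).
Local Notation fXi := (<< fmu genXi >> : F).
Local Notation fe := (<< fmu genE >> : F).

Inductive bmw2_rel : F -> F -> Prop :=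
| bmw2_YYi : bmw2_rel (fY * fYi) 1
| bmw2_YiY : bmw2_rel (fYi * fY) 1
| bmw2_XXi : bmw2_rel (fX * fXi) 1
| bmw2_XiX : bmw2_rel (fXi * fX) 1
| bmw2_Yk : bmw2_rel (fY ^+ k) (\sum_(i < k) qs i *: fY ^+ i)
| bmw2_skein : bmw2_rel (fX - fXi) (delta *: (1 - fe))
| bmw2_braid : bmw2_rel (fX * fY * fX * fY) (fY * fX * fY * fX)
| bmw2_Xe : bmw2_rel (fX * fe) (lam *: fe)
| bmw2_eX : bmw2_rel (fe * fX) (lam *: fe)
| bmw2_YXYe : bmw2_rel (fY * fX * fY * fe) (lam^-1 *: fe)
| bmw2_eYXY : bmw2_rel (fe * fY * fX * fY) (lam^-1 *: fe)
| bmw2_eYme (m : nat) : (m < k)%N -> bmw2_rel (fe * fY ^+ m * fe) (A m *: fe).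

Definition bmw2 : Type := palg bmw2_rel.
HB.instance Definition _ := GRing.PzRing.on bmw2.
HB.instance Definition _ := GRing.Lmodule.on bmw2.

Definition bmwY : bmw2 := palg_gen bmw2_rel genY.
Definition bmwX : bmw2 := palg_gen bmw2_rel genX.
Definition bmwXi : bmw2 := palg_gen bmw2_rel genXi.
Definition bmwE : bmw2 := palg_gen bmw2_rel genE.

Definition adm_beta : R :=
  qs 0 * lam - (qs 0)^-1 * lam^-1 + (1 - (odd k)%:R) * delta.

(* Here z = uphalf k.  All truncated subtractions are exact in the ranges used,
   i.e. for 1 <= l < k. *)
Definition adm_h (l : nat) : R :=
  lam^-1 * (qcoef k qs l + (qs 0)^-1 * qcoef k qs (k - l)) +
  delta * (\sum_(1 <= r < (k - l).+1) qcoef k qs (r + l) * A r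
           - \sum_(maxn l.+1 (uphalf k) <= i < ((l + k)./2).+1)
               qcoef k qs (2 * i - l)
           + \sum_(uphalf l <= i < (minn l (uphalf k).-1).+1)
               qcoef k qs (2 * i - l)).

Definition admissible : Prop :=
  [/\ lam - lam^-1 = delta * (1 - A 0),
      forall l, (1 <= l < k)%N -> adm_h l = 0
    & adm_beta = 0].

(* The free module V is 'cV[R]_k, and its endomorphisms are the square matrices
   acting by left multiplication.  vbas i is the basis vector v_i (junk value 0
   for i >= k). *)
Definition vbas (i : nat) : 'cV[R]_k := \col_(j < k) (val j == i)%:R.

(* the linear map sending v_i to f i *)
Definition mx_of_basis (f : nat -> 'cV[R]_k) : 'M[R]_k :=
  \matrix_(i < k, j < k) f j i 0.

Lemma mx_of_basisE (f : nat -> 'cV[R]_k) (i : nat) :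
  (i < k)%N -> mx_of_basis f *m vbas i = f i.
Proof.
move=> ltik; apply/colP=> j; rewrite !mxE (bigD1 (Ordinal ltik)) //= !mxE.
rewrite eqxx mulr1 big1 ?addr0 // => r; rewrite -val_eqE !mxE /= => /negPf->.
by rewrite mulr0.
Qed.

Definition Ybar : 'M[R]_k :=
  mx_of_basis (fun i =>
    if (i.+1 < k)%N then vbas i.+1 else \sum_(j < k) qs j *: vbas j).

Fixpoint Xcol (i : nat) : 'cV[R]_k :=
  match i with
  | 0 => lam *: vbas 0
  | i1.+1 =>
    match i1 with
    | 0 => lam^-1 *: (invmx Ybar *m vbas 0)
    | i2.+1 => invmx Ybar *m Xcol i1 - delta *: vbas i2
               + (delta * A i1) *: (invmx Ybar *m vbas 0)
    end
  end.

Definition Xbar : 'M[R]_k := mx_of_basis Xcol.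

Definition Ebar : 'M[R]_k := mx_of_basis (fun i => A i *: vbas 0).

Definition Wbar : 'M[R]_k := Xbar - delta%:M + delta *: Ebar.

Lemma mx_basis_ext (M N : 'M[R]_k) :
  (forall i, (i < k)%N -> M *m vbas i = N *m vbas i) -> M = N.
Proof.
have colE (P : 'M[R]_k) (j : 'I_k) : P *m vbas j = col j P.
  rewrite -[RHS]/(col j P) colE; congr (_ *m _).
  by apply/colP=> i; rewrite !mxE eqxx andbT val_eqE.
move=> eqMN; apply/matrixP=> i j; have := eqMN j (ltn_ord j).
by rewrite !colE => /colP/(_ i); rewrite !mxE.
Qed.

(* so that invmx Ybar is the inverse of Ybar *)
Lemma Ybar_unit : qs 0 \is a GRing.unit -> Ybar \in unitmx.
Proof.
move=> uq0; case: (posnP k) => [k0|k_gt0].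
  by apply: (@mulmx1_unit _ _ _ 1%:M _).1; apply: mx_basis_ext => i lti;
    exfalso; move: lti; rewrite k0.
pose Z := mx_of_basis (fun i => if i is i'.+1 then vbas i' else
  (qs 0)^-1 *: (vbas k.-1 - \sum_(j < k | (0 < j)%N) qs j *: vbas j.-1)).
have Yv i : (i.+1 < k)%N -> Ybar *m vbas i = vbas i.+1.
  by move=> lti; rewrite mx_of_basisE ?lti // ltnW.
apply: (@mulmx1_unit _ _ _ Z _).1; apply: mx_basis_ext => [[|i]] lti.
  rewrite -mulmxA mx_of_basisE // mul1mx -scalemxAr mulmxBr.
  rewrite mx_of_basisE ?prednK // ltnn mulmx_sumr.
  rewrite (bigD1 (Ordinal k_gt0)) //=.
  rewrite (eq_bigl (fun j : 'I_k => (0 < j)%N)); last first.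
    by move=> j; rewrite -val_eqE /= lt0n.
  rewrite (eq_bigr (fun j : 'I_k => Ybar *m (qs j *: vbas j.-1))); last first.
    by move=> j j0; rewrite -scalemxAr Yv prednK.
  by rewrite addrK scalerA mulVr ?scale1r.
by rewrite -mulmxA mx_of_basisE // mul1mx Yv.
Qed.

End BMW.

(* Main.v *)
From HB Require Import structures.
Require Import Defs.
From mathcomp Require Import all_boot all_algebra.
From mathcomp Require Import zify ring.
From mathcomp.multinomials Require Import monalg.
Import GRing.Theory.
Local Open Scope ring_scope.

(** The point is that all relations follow from three facts: Y X Y = W,
    X W = 1 and E X = lam E.  Indeed W is X - delta + delta E by definition, so
    with W = X^-1 both sides of the braid relation are 1, and E W = W E = lam^-1 E
    because lam - delta + delta A_0 = lam^-1 and E^2 = A_0 E.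

    Y X Y = W.  As V is generated by v_0 under Y, put u_n = Y^n v_0, so that
    v_i = u_i for i < k.  The recursion defining the columns x_i = X v_i says
    that Y x_(i+1) = W v_i, so Y X Y and W agree on v_0, ..., v_(k-2)
    by construction.  If the recursion is used once more to define x_k, then
    agreement on v_(k-1) is the vanishing of q_0 x_0 + ... + q_k x_k
    (sum_qcoef_Xcol).  Solving the recursion (Xcol_closed) turns Y^k times this
    sum into a combination of the u_n, and this is where admissibility enters:
    h_l = 0 replaces the part containing A_1, ..., A_(k-1), beta = 0 replaces
    the coefficient of u_k, and the remaining double sums recombine into
    instances of the recurrence satisfied by the u_n (area_split,
    admissible_sum).

    E X = lam E and X W = 1.  Write E = v_0 phi with phi a linear form, and let
    c = lam phi - phi X be the defect of the first identity and N = X W - 1 that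
    of the second one.  From Y (X W) = (Y X Y) X Y = (W X) Y and
    X W - W X = delta v_0 c one gets N Y = Y N + delta v_0 c Y, while
    N v_0 = 0.  Hence N u_i is delta times the convolution of c(u_1), ...,
    c(u_i) with u_(i-1), ..., u_0.  Applying N to the recurrence of the u_i,
    cancelling the regular element delta and reading off the coefficients from
    v_(k-1) downwards gives c(u_1) = c(u_2) = ... = 0, since q_k = -1
    (twisted_commutator_vanish).  So c = 0, N commutes with Y, and N = 0.

    The module structure is then the universal property of an algebra given by
    generators and relations (palg_eval, bmw2_matrix_module). *)

(** * Evaluating an algebra given by generators and relations *)

Section Eval.
Variables (R : comNzRingType) (G : choiceType) (S : algType R) (M : G -> S).
Local Notation F := {malg R[{fmonom G}]}.

Definition word_eval (w : {fmonom G}) : S := \prod_(g <- (w : seq G)) M g.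

Lemma word_eval_mmorphism : mmorphism word_eval.
Proof.
split; last by rewrite /word_eval fm1 big_nil.
by move=> w1 w2; rewrite /word_eval fmM big_cat.
Qed.

HB.instance Definition _ :=
  monalg.isMultiplicative.Build {fmonom G} S word_eval word_eval_mmorphism.

Definition free_eval : F -> S := mmap (in_alg S) word_eval.

HB.instance Definition _ := GRing.Additive.copy free_eval free_eval.

Lemma free_eval_monoid_morphism : monoid_morphism free_eval.
Proof.
have [|mM m1] := @commr_mmap_is_multiplicative _ R S (in_alg S) word_eval.
  by move=> g m m'; rewrite /GRing.comm /= -scalerAl mul1r -scalerAr mulr1.
by split.
Qed.

HB.instance Definition _ :=
  GRing.isMonoidMorphism.Build F S free_eval free_eval_monoid_morphism.

Lemma free_evalZ : scalable free_eval.
Proof. by move=> c x; rewrite /free_eval mmapZ /= -scalerAl mul1r. Qed.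

Lemma free_eval_gen g : free_eval << fmu g >> = M g.
Proof.
by rewrite /free_eval mmapU /= scale1r mul1r /word_eval fmU big_seq1.
Qed.

Variable rel : F -> F -> Prop.
Hypothesis free_eval_rel : forall x y, rel x y -> free_eval x = free_eval y.

Definition palg_eval (u : palg rel) : S := free_eval (repr u).

(** Once the relations hold in S, an element of the ideal that they generate
    evaluates to 0, so the value does not depend on the representative. *)
Lemma palg_eval_pi x : palg_eval (palg_pi rel x) = free_eval x.
Proof.
have /rel_idealP : repr (palg_pi rel x) - x \in rel_ideal rel.
  by apply/palg_eqP; rewrite palg_piK.
rewrite /palg_eval => ideal_x; apply/eqP; rewrite -subr_eq0 -raddfB; apply/eqP.
elim: ideal_x => [|y1 y2 _ h1 _ h2|a b y1 y2 /free_eval_rel h].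
- exact: raddf0.
- by rewrite /= raddfD /= h1 h2 addr0.
- by rewrite /= !rmorphM rmorphB /= h subrr mulr0 mul0r.
Qed.

Lemma palg_evalD : {morph palg_eval : u v / u + v}.
Proof.
move=> u v; rewrite -[u]palg_piK -[v]palg_piK -palg_piD !palg_eval_pi.
exact: raddfD.
Qed.

Lemma palg_evalM : {morph palg_eval : u v / u * v}.
Proof.
move=> u v; rewrite -[u]palg_piK -[v]palg_piK.
rewrite -[_ * _]/(palg_mul _ _) -palg_piM !palg_eval_pi; exact: rmorphM.
Qed.

Lemma palg_evalZ c u : palg_eval (c *: u) = c *: palg_eval u.
Proof.
rewrite -[u]palg_piK -[_ *: _]/(palg_scale _ _) -palg_piZ !palg_eval_pi.
exact: free_evalZ.
Qed.

Lemma palg_eval1 : palg_eval 1 = 1.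
Proof. by rewrite -[1]/(palg_pi _ 1) palg_eval_pi rmorph1. Qed.

Lemma palg_eval_gen g : palg_eval (palg_gen rel g) = M g.
Proof. by rewrite palg_eval_pi free_eval_gen. Qed.
End Eval.

(** * The two string algebra acting through matrices *)

Definition bmw_image (T : Type) (y yi x xi e : T) (g : bmw_gen) : T :=
  match g with
  | genY => y | genYi => yi | genX => x | genXi => xi | genE => e
  end.

(** The relations of the algebra, read as hypotheses on five elements of an
    arbitrary algebra S. *)
Lemma bmw2_free_eval (R : comUnitRingType) (k : nat) (A qs : nat -> R)
    (q lam : R) (S : algType R) (y yi x xi e : S) :
  y * yi = 1 -> yi * y = 1 -> x * xi = 1 -> xi * x = 1 ->
  y ^+ k = \sum_(i < k) qs i *: y ^+ i ->
  x - xi = (q - q^-1) *: (1 - e) ->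
  x * y * x * y = y * x * y * x ->
  x * e = lam *: e -> e * x = lam *: e ->
  y * x * y * e = lam^-1 *: e -> e * y * x * y = lam^-1 *: e ->
  (forall m, (m < k)%N -> e * y ^+ m * e = A m *: e) ->
  let ev := free_eval R bmw_gen S (bmw_image S y yi x xi e) in
  forall a b, bmw2_rel k A qs q lam a b -> ev a = ev b.
Proof.
move=> yyi yiy xxi xix yk skein braid xe ex yxye exyx eye ev a b rel_ab.
have gen g : ev << fmu g >> = bmw_image S y yi x xi e g by exact: free_eval_gen.
have evM : {morph ev : c d / c * d} by exact: rmorphM.
have evB : {morph ev : c d / c - d} by exact: raddfB.
have ev1 : ev 1 = 1 by exact: rmorph1.
have evX n : {morph ev : c / c ^+ n} by exact: rmorphXn.
have evZ c : {morph ev : d / c *: d} by exact: free_evalZ.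
have evS (f : 'I_k -> _) : ev (\sum_i f i) = \sum_i ev (f i).
  exact: raddf_sum.
(* From here on only the morphism properties of ev are used.  The generators are
   turned into variables too: two monomials are then compared syntactically,
   and not through the convolution product that defines their product. *)
move: ev gen evM evB ev1 evX evZ evS => ev gen evM evB ev1 evX evZ evS.
case: rel_ab => [|||||||||||m lt_m];
  move: (gen genY) (gen genYi) (gen genX) (gen genXi) (gen genE) => /=;
  move: << fmu genY >> << fmu genYi >> << fmu genX >> << fmu genXi >>
    << fmu genE >> => Y Yi X Xi e' evY evYi evx evXi eve.
- by rewrite evM evY evYi yyi.
- by rewrite evM evY evYi yiy.
- by rewrite evM evx evXi xxi.
- by rewrite evM evx evXi xix.
- rewrite evX evY yk evS; apply: eq_bigr => i _.
  by rewrite evZ evX evY.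
- by rewrite evB evZ evB ev1 evx evXi eve.
- transitivity (x * y * x * y); last rewrite braid.
    by rewrite !evM evY evx.
  by rewrite !evM evY evx.
- by rewrite evM evZ evx eve.
- by rewrite evM evZ evx eve.
- by rewrite !evM evZ evY evx eve.
- by rewrite !evM evZ evY evx eve.
- by rewrite !evM evZ evX evY eve eye.
Qed.

Lemma bmw2_matrix_module (R : comUnitRingType) (k n : nat) (A qs : nat -> R)
    (q lam : R) (y yi x xi e : 'M[R]_n.+1) :
  y * yi = 1 -> yi * y = 1 -> x * xi = 1 -> xi * x = 1 ->
  y ^+ k = \sum_(i < k) qs i *: y ^+ i ->
  x - xi = (q - q^-1) *: (1 - e) ->
  x * y * x * y = y * x * y * x ->
  x * e = lam *: e -> e * x = lam *: e ->
  y * x * y * e = lam^-1 *: e -> e * y * x * y = lam^-1 *: e ->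
  (forall m, (m < k)%N -> e * y ^+ m * e = A m *: e) ->
  exists2 act : bmw2 k A qs q lam -> 'cV[R]_n.+1 -> 'cV[R]_n.+1,
    is_left_module act &
    [/\ forall (c : R) v, act (c *: (1 : bmw2 k A qs q lam)) v = c *: v,
        forall v, act (bmwY k A qs q lam) v = y *m v,
        forall v, act (bmwX k A qs q lam) v = x *m v,
        forall v, act (bmwXi k A qs q lam) v = xi *m v
      & forall v, act (bmwE k A qs q lam) v = e *m v].
Proof.
move=> yyi yiy xxi xix yk skein braid xe ex yxye exyx eye.
have rel_ev := bmw2_free_eval _ _ _ _ _ _ _ _ _ _ _ _ yyi yiy xxi xix yk skein
  braid xe ex yxye exyx eye.
pose ev := palg_eval R bmw_gen 'M[R]_n.+1 (bmw_image _ y yi x xi e)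
  (bmw2_rel k A qs q lam).
have evM b c : ev (b * c) = ev b *m ev c by exact: palg_evalM.
have evD b c : ev (b + c) = ev b + ev c by exact: palg_evalD.
have evZ c b : ev (c *: b) = c *: ev b by exact: palg_evalZ.
have ev1 : ev 1 = 1%:M by exact: palg_eval1.
have gen g : ev (palg_gen _ g) = bmw_image _ y yi x xi e g.
  exact: palg_eval_gen.
exists (fun b v => ev b *m v).
  split=> [b c v|v|b v w|v b c].
  - by rewrite mulmxA -evM.
  - by rewrite ev1 mul1mx.
  - exact: mulmxDr.
  - by rewrite evD mulmxDl.
split=> [c v|v|v|v|v]; last 4 first.
- by rewrite [ev _]gen.
- by rewrite [ev _]gen.
- by rewrite [ev _]gen.
- by rewrite [ev _]gen.
by rewrite evZ ev1 -scalemxAl mul1mx.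
Qed.

(** * Reindexing double sums *)

Section Sums.
Variable V : zmodType.
Implicit Types f : nat -> V.

Lemma sum_nat_indicator f m n N : (n <= N)%N ->
  \sum_(m <= i < n) f i = \sum_(0 <= i < N | (m <= i < n)%N) f i.
Proof.
move=> le_nN; rewrite (big_nat_widen _ _ _ _ _ le_nN) /=.
rewrite (big_nat_widenl m 0) //; apply: eq_bigl => i; exact: andbC.
Qed.

(** The reflection l |-> m - l maps P to Q and Q to P. *)
Lemma sum_nat_reflect f (m N : nat) (P Q : pred nat) :
  (forall l, (l < N)%N -> P l -> [/\ l <= m, m - l < N & Q (m - l)]%N) ->
  (forall r, (r < N)%N -> Q r -> [/\ r <= m, m - r < N & P (m - r)]%N) ->
  \sum_(0 <= l < N | P l) f (m - l)%N = \sum_(0 <= r < N | Q r) f r.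
Proof.
case: N => [|N] PQ QP; first by rewrite !big_geq.
rewrite !big_mkord.
pose h (l : 'I_N.+1) : 'I_N.+1 := inord (m - l).
rewrite (reindex_onto h h) /=; last first.
  move=> l /(PQ _ (ltn_ord l)) [le_lm lt_mlN _]; apply: val_inj.
  by rewrite /= /h !inordK ?subKn.
apply: eq_big => [r|r /andP[Ph /eqP hr]].
  apply/andP/idP => [[/(PQ _ (ltn_ord _)) [_ lt_N Qh] /eqP hhr]|Qr].
    by move: Qh; rewrite -[X in Q X -> _](inordK lt_N) -/(h (h r)) hhr.
  have [le_rm lt_N Pr] := QP _ (ltn_ord r) Qr.
  have hE : h r = (m - r)%N :> nat by rewrite inordK.
  by rewrite hE; split=> //; apply/eqP/val_inj; rewrite /= /h inordK hE subKn.
have [_ lt_N _] := PQ _ (ltn_ord _) Ph.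
by rewrite -[X in f X = _](inordK lt_N) -/(h (h r)) hr.
Qed.

Variables (k : nat) (F : nat -> nat -> V).
Hypothesis k_gt0 : (0 < k)%N.
Local Notation z := (uphalf k).

(* The sum of F over the points (i, r) of the square [0, k]^2 that satisfy P. *)
Let area (P : nat -> nat -> bool) :=
  \sum_(0 <= i < k.+1) \sum_(0 <= r < k.+1) if P i r then F i r else 0.

(** For fixed i, the substitution r = 2 i - l turns a sum over pairs (l, i), the
    form in which the sums of h_l are written, into a sum over points (i, r). *)
Lemma areaE (lo hi : nat -> nat) (P : nat -> nat -> bool) :
  (forall l, (1 <= l < k)%N -> (hi l <= k.+1)%N) ->
  (forall l i, (1 <= l < k)%N -> (lo l <= i < hi l)%N ->
     [/\ l <= 2 * i, 2 * i - l <= k & P i (2 * i - l)]%N) ->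
  (forall i r, (i <= k)%N -> (r <= k)%N -> P i r ->
     [/\ r <= 2 * i, 1 <= 2 * i - r < k
       & lo (2 * i - r) <= i < hi (2 * i - r)]%N) ->
  \sum_(1 <= l < k) \sum_(lo l <= i < hi l) F i (2 * i - l)%N = area P.
Proof.
move=> hiP loP Plo.
rewrite (sum_nat_indicator _ 1 k k.+1) //.
under eq_bigr => l /hiP le_hi do
  rewrite (sum_nat_indicator _ _ _ _ le_hi) big_mkcond.
rewrite big_mkcond /=.
transitivity (\sum_(0 <= l < k.+1) \sum_(0 <= i < k.+1)
  if (1 <= l < k)%N && (lo l <= i < hi l)%N then F i (2 * i - l)%N else 0).
  by apply: eq_bigr => l _; case: ifP => //= _; rewrite big1.
rewrite exchange_big_nat /=; apply: eq_big_nat => i /= lt_ik.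
rewrite -!big_mkcond /=; apply: sum_nat_reflect => [l _ /andP[l1 l2]|r lt_rk].
  by have [] := loP _ _ l1 l2; split.
move=> /Plo [] // le_ri r1 r2; split=> //; last by rewrite r1.
by case/andP: r1 => _ /ltnW.
Qed.

(** The heart of the combinatorics.  In the plane of points (i, r) with
    0 <= r <= k, the two sums on the left run over 1 <= i < r (put i = r - j)
    and over r <= i < z, i >= 1; on the right, the first sum runs over i >= z,
    i < r < 2 i and the second one over the full columns 1 <= i < z.  The left
    regions cover these columns once, and beyond them i >= z and i < r leave
    only one point with r >= 2 i: as 2 z >= k >= r, it is r = k = 2 z, which
    exists for even k. *)
Lemma area_split :
  \sum_(1 <= r < k.+1) \sum_(1 <= j < r) F (r - j)%N r
  + \sum_(1 <= l < k) \sum_(uphalf l <= i < (minn l z.-1).+1) F i (2 * i - l)%N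
  = \sum_(1 <= l < k)
      \sum_(maxn l.+1 z <= i < ((l + k)./2).+1) F i (2 * i - l)%N
    + \sum_(1 <= i < z) \sum_(0 <= r < k.+1) F i r
    + (if odd k then 0 else F z k).
Proof.
rewrite (areaE _ _ (fun i r => [&& r <= i, i < z & 0 < i])%N); first last.
- by move=> i r *; split; lia.
- by move=> l i *; split; lia.
- by move=> l; lia.
rewrite (areaE _ _ (fun i r => [&& z <= i, i < r & r < 2 * i])%N); first last.
- by move=> i r *; split; lia.
- by move=> l i *; split; lia.
- by move=> l; lia.
have -> : \sum_(1 <= i < z) \sum_(0 <= r < k.+1) F i r
  = area (fun i r => 0 < i < z)%N.
  rewrite (sum_nat_indicator _ 1 z k.+1); last by lia.
  rewrite big_mkcond; apply: eq_bigr => i _; case: ifP => // _.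
  by rewrite big1.
have -> : \sum_(1 <= r < k.+1) \sum_(1 <= j < r) F (r - j)%N r
  = area (fun i r => 0 < i < r)%N.
  rewrite /area exchange_big_nat /= [RHS]big_ltn // [X in _ = X + _]big1 ?add0r.
    apply: eq_big_nat => r /andP[_ lt_r]; rewrite -big_mkcond /=.
    rewrite (sum_nat_indicator _ _ _ k.+1); last by lia.
    by apply: (sum_nat_reflect (F^~ r)) => j *; split; lia.
  by move=> i _; rewrite ltn0 andbF.
have -> : (if odd k then 0 else F z k)
  = area (fun i r => [&& ~~ odd k, i == z & r == k])%N.
  rewrite /area; case: (odd k) => /=.
    by rewrite big1 // => i _; rewrite big1.
  rewrite (bigD1_seq z) ?iota_uniq ?mem_index_iota //=; last by lia.
  rewrite [X in X + _](bigD1_seq k) ?iota_uniq ?mem_index_iota //=.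
  rewrite !eqxx /= big1 ?addr0 => [|r /negPf -> //].
  rewrite big1 ?addr0 => [//|i /negPf nz].
  by rewrite big1 // => r _; rewrite nz.
rewrite /area -!big_split; apply: eq_big_nat => i /andP[_ lt_i] /=.
rewrite -!big_split; apply: eq_big_nat => r /andP[_ lt_r] /=.
do 5!case: ifP; rewrite ?addr0 ?add0r //; lia.
Qed.
End Sums.

(** * Admissibility as a linear relation *)

Section Adm.
Variables (R : comUnitRingType) (k : nat) (A qs : nat -> R) (q lam : R).
Variables (V : lmodType R) (u : nat -> V).
Local Notation delta := (q - q^-1).
Local Notation Q := (qcoef k qs).

(** Substituting l = i - j collects the terms with the same vector u (k - l). *)
Lemma sum_nat_shift_diff (c : nat -> nat -> R) :
  \sum_(1 <= i < k.+1) \sum_(1 <= j < i) c i j *: u (k + j - i)%N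
  = \sum_(1 <= l < k)
      (\sum_(1 <= r < (k - l).+1) c (r + l)%N r) *: u (k - l)%N.
Proof.
transitivity (\sum_(1 <= j < k)
    \sum_(j.+1 <= i < k.+1) c i j *: u (k + j - i)%N).
  pose g i j : V := if (j < i)%N then c i j *: u (k + j - i)%N else 0.
  transitivity (\sum_(1 <= i < k.+1) \sum_(1 <= j < k) g i j).
    apply: eq_big_nat => i /andP[_ lt_i].
    rewrite (big_nat_widen _ _ k) ?big_mkcond; last by lia.
    by apply: eq_bigr.
  rewrite exchange_big_nat; apply: eq_big_nat => j /andP[j_gt0 _].
  rewrite [RHS](big_nat_widenl _ 1) ?[RHS]big_mkcond; last by lia.
  by apply: eq_bigr.
transitivity (\sum_(1 <= j < k)
    \sum_(1 <= l < (k - j).+1) c (j + l)%N j *: u (k - l)%N).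
  apply: eq_big_nat => j /andP[_ lt_j].
  rewrite -[j.+1]add1n big_addn subSn; last by lia.
  by apply: eq_big_nat => l _; rewrite addnC; congr (_ *: u _); lia.
pose g l j : V := if (l + j <= k)%N then c (j + l)%N j *: u (k - l)%N else 0.
transitivity (\sum_(1 <= j < k) \sum_(1 <= l < k) g l j).
  apply: eq_big_nat => j /andP[j_gt0 lt_j].
  rewrite (big_nat_widen _ _ k) ?big_mkcond; last by lia.
  by apply: eq_bigr => l _; rewrite /g; do 2!case: ifP => //; lia.
rewrite exchange_big_nat; apply: eq_big_nat => l /andP[l_gt0 lt_l].
rewrite scaler_suml [RHS](big_nat_widen _ _ k) ?[RHS]big_mkcond; last by lia.
by apply: eq_bigr => r _; rewrite /g; do 2!case: ifP => //; lia.
Qed.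

Hypothesis k_gt0 : (0 < k)%N.
Hypothesis q0_unit : qs 0%N \is a GRing.unit.
Hypothesis u_rec : forall n, \sum_(0 <= r < k.+1) Q r *: u (n + r)%N = 0.
Hypothesis adm : admissible k A qs q lam.

(** With u n = Y^n v_0, the left side is Y^k times the sum of the q_i X v_i
    over 0 <= i <= k; the factor Y^k keeps all exponents nonnegative. *)
Lemma admissible_sum :
  (qs 0%N * lam) *: u k +
  \sum_(1 <= i < k.+1) Q i *:
    (lam^-1 *: u (k - i)%N - delta *: \sum_(1 <= j < i) u (k + 2 * j - i)%N
     + delta *: \sum_(1 <= j < i) A j *: u (k + j - i)%N) = 0.
Proof.
have [_ adm_h0 adm_b0] := adm.
have Q0 : Q 0 = qs 0%N.
  by rewrite /qcoef; case: eqP => // k0; move: k_gt0; rewrite -k0.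
have Qk : Q k = -1 by rewrite /qcoef eqxx.
pose F i r : V := Q r *: u (k + r - 2 * i)%N.
pose D := \sum_(1 <= r < k.+1) \sum_(1 <= j < r) F (r - j)%N r.
pose L := \sum_(1 <= l < k) \sum_(uphalf l <= i < (minn l (uphalf k).-1).+1)
  F i (2 * i - l)%N.
pose H := \sum_(1 <= l < k)
   \sum_(maxn l.+1 (uphalf k) <= i < ((l + k)./2).+1) F i (2 * i - l)%N.
(* Each full column of area_split is an instance of the recurrence; its extra
   point has coefficient q_k = -1 and yields the term (1 - epsilon) u_k. *)
have DLH : H - L - D = (1 - (odd k)%:R) *: u k.
  have := area_split _ k F k_gt0; rewrite -/D -/L -/H.
  rewrite [X in _ = H + X + _]big_nat big1 ?addr0 => [|i /andP[i1 iz]];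
    last first.
    rewrite -[RHS](u_rec (k - 2 * i)); apply: eq_bigr => r _.
    by congr (_ *: u _); lia.
  move=> DL; rewrite -addrA -opprD [L + D]addrC DL opprD addrA subrr add0r.
  case: ifPn => odd_k; first by rewrite subrr scale0r oppr0.
  rewrite subr0 scale1r /F Qk scaleN1r opprK; congr (u _); lia.
pose B := \sum_(1 <= l < k) Q l *: u (k - l)%N.
have BE : \sum_(1 <= i < k.+1) Q i *: u (k - i)%N = B - u 0%N.
  by rewrite big_nat_recr //= Qk subnn scaleN1r.
have B'E : \sum_(1 <= l < k) Q (k - l)%N *: u (k - l)%N
    = u k - qs 0%N *: u 0%N.
  have := u_rec 0; rewrite big_nat_recr //= big_ltn //= Q0 Qk scaleN1r.
  rewrite big_nat_rev /= => /eqP; rewrite subr_eq0 !add0n => /eqP <-.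
  rewrite addrC addrK; apply: eq_big_nat => l /andP[l1 lk].
  by rewrite add0n add1n subSS.
(* T, G and M are the three sums of h_l; the vectors that they multiply add up
   to C, H and L. *)
pose C := \sum_(1 <= i < k.+1) \sum_(1 <= j < i) (Q i * A j) *: u (k + j - i)%N.
pose G l := \sum_(maxn l.+1 (uphalf k) <= i < ((l + k)./2).+1) Q (2 * i - l)%N.
pose M l := \sum_(uphalf l <= i < (minn l (uphalf k).-1).+1) Q (2 * i - l)%N.
have HE : H = \sum_(1 <= l < k) G l *: u (k - l)%N.
  apply: eq_big_nat => l _; rewrite scaler_suml.
  by apply: eq_big_nat => i lt_i; congr (_ *: u _); lia.
have LE : L = \sum_(1 <= l < k) M l *: u (k - l)%N.
  apply: eq_big_nat => l _; rewrite scaler_suml.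
  by apply: eq_big_nat => i lt_i; congr (_ *: u _); lia.
pose T l := \sum_(1 <= r < (k - l).+1) Q (r + l)%N * A r.
have CT : C = \sum_(1 <= l < k) T l *: u (k - l)%N.
  exact: (sum_nat_shift_diff (fun i j => Q i * A j)).
have CE : delta *: C = - lam^-1 *: B
    - (lam^-1 * (qs 0%N)^-1) *: (u k - qs 0%N *: u 0%N) + delta *: (H - L).
  rewrite CT -B'E HE LE -sumrB !scaler_sumr -sumrB -big_split /=.
  apply: eq_big_nat => l /adm_h0; rewrite /adm_h -/(T l) -/(G l) -/(M l).
  rewrite !scalerA -!scalerBl scalerA -scalerDl => h0.
  congr (_ *: _); rewrite -[LHS]subr0 -h0; ring.
have -> : \sum_(1 <= i < k.+1) Q i *:
    (lam^-1 *: u (k - i)%N - delta *: \sum_(1 <= j < i) u (k + 2 * j - i)%N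
     + delta *: \sum_(1 <= j < i) A j *: u (k + j - i)%N)
  = lam^-1 *: (B - u 0%N) - delta *: D + delta *: C.
  rewrite -BE !scaler_sumr -sumrB -big_split; apply: eq_big_nat => i lt_i /=.
  rewrite scalerDr scalerBr !scalerA ![Q i * _]mulrC -!scalerA !scaler_sumr.
  congr (_ - _ + _); last by apply: eq_bigr => j _; rewrite [Q i *: _]scalerA.
  by apply: eq_big_nat => j lt_j; congr (_ *: (_ *: u _)); lia.
have -> : D = H - L - (1 - (odd k)%:R) *: u k by rewrite -DLH subKr.
have eE : (lam^-1 * (qs 0%N)^-1) *: (u k - qs 0%N *: u 0%N)
    = (lam^-1 * (qs 0%N)^-1) *: u k - lam^-1 *: u 0%N.
  by rewrite scalerBr scalerA mulrVK.
rewrite CE eE [lam^-1 *: (B - _)]scalerBr [delta *: (H - L - _)]scalerBr.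
rewrite scaleNr !opprB scalerA.
(* Pair the terms that cancel: B, u_0 and delta (H - L) each occur with both
   signs, and the coefficient of u_k that remains is beta. *)
rewrite [LHS](AC (1*((2*2)*((1*2)*1))) ((1*4*8)*((2*6)*(3*7)*(5*9)))) /=.
rewrite !subrr !addNr !addr0 -scalerDl -scalerBl -[RHS](scale0r (u k)).
by congr (_ *: _); rewrite -adm_b0 /adm_beta; ring.
Qed.
End Adm.

(** * The maps Y, X, E and W on V *)

Section Representation.
Variables (R : comUnitRingType) (k : nat) (A qs : nat -> R) (q lam : R).
Hypothesis k_gt0 : (0 < k)%N.
Hypothesis q0_unit : qs 0%N \is a GRing.unit.
Hypothesis lam_unit : lam \is a GRing.unit.
Hypothesis delta_reg : GRing.lreg (q - q^-1).
Hypothesis adm : admissible k A qs q lam.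

Local Notation delta := (q - q^-1).
Local Notation Q := (qcoef k qs).
Local Notation v := (vbas R k).
Local Notation Y := (Ybar k qs).
Local Notation Yi := (invmx Y).
Local Notation X := (Xbar k A qs q lam).
Local Notation E := (Ebar k A).
Local Notation W := (Wbar k A qs q lam).
Local Notation xc := (Xcol k A qs q lam).

(* The orbit of v_0 under Y, which extends the basis beyond v_(k-1). *)
Let u n : 'cV[R]_k := Y ^+ n *m v 0.

Lemma mulYu n : Y *m u n = u n.+1.
Proof. by rewrite /u exprS -mulmxA. Qed.

Lemma mulYiu n : Yi *m u n.+1 = u n.
Proof. by rewrite -mulYu mulKmx // Ybar_unit. Qed.

Lemma mulYnu m n : Y ^+ m *m u n = u (m + n)%N.
Proof. by rewrite /u mulmxA -[_ *m _ ^+ _]exprD. Qed.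

Lemma vbas_u i : (i < k)%N -> v i = u i.
Proof.
elim: i => [|i IHi] lt_i; first by rewrite /u expr0 mul1mx.
by rewrite -mulYu -IHi ?(ltnW lt_i) // mx_of_basisE ?(ltnW lt_i) // lt_i.
Qed.

Lemma qcoef_lt i : (i < k)%N -> Q i = qs i.
Proof. by rewrite /qcoef; case: eqP => // ->; rewrite ltnn. Qed.

Lemma qcoef_k : Q k = -1.
Proof. by rewrite /qcoef eqxx. Qed.

Lemma u_rec n : \sum_(0 <= r < k.+1) Q r *: u (n + r)%N = 0.
Proof.
have rec0 : \sum_(0 <= r < k.+1) Q r *: u r = 0.
  rewrite big_nat_recr //= qcoef_k scaleN1r; apply/eqP; rewrite subr_eq0.
  have := mx_of_basisE (fun i =>
    if (i.+1 < k)%N then v i.+1 else \sum_(j < k) qs j *: v j)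
    (i := k.-1); rewrite -/(Ybar k qs) prednK // ltnn => /(_ (leqnn _)).
  rewrite vbas_u ?prednK // mulYu prednK // => ->; rewrite big_mkord.
  by apply/eqP/eq_bigr => j _; rewrite qcoef_lt // vbas_u.
transitivity (Y ^+ n *m \sum_(0 <= r < k.+1) Q r *: u r); last first.
  by rewrite rec0 mulmx0.
by rewrite mulmx_sumr; apply: eq_bigr => r _; rewrite -scalemxAr mulYnu.
Qed.

Lemma Ybar_poly : \sum_(l < k.+1) Q l *: Y ^+ l = 0.
Proof.
apply: mx_basis_ext => i lt_i; rewrite mul0mx.
have := u_rec i; rewrite big_mkord => urec; rewrite -[RHS]urec mulmx_suml.
apply: eq_bigr => l _.
by rewrite -scalemxAl vbas_u // mulYnu addnC.
Qed.

(** The closed form of the recursion, multiplied by Y^k.  The value i = k, one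
    past the last basis vector, is included on purpose: Xcol k is what X v_k
    would be. *)
Lemma Xcol_closed i : (0 < i <= k)%N ->
  Y ^+ k *m xc i =
    lam^-1 *: u (k - i)%N - delta *: \sum_(1 <= j < i) u (k + 2 * j - i)%N
     + delta *: \sum_(1 <= j < i) A j *: u (k + j - i)%N.
Proof.
have commYi m : Y ^+ m *m Yi = Yi *m Y ^+ m.
  case: m => [|m]; first by rewrite expr0 mul1mx mulmx1.
  rewrite {1}exprSr exprS -[_ * Y]/(_ *m _) -[Y * _]/(_ *m _).
  by rewrite mulmxK ?mulKmx // Ybar_unit.
have YkYi : Y ^+ k *m (Yi *m v 0) = u k.-1.
  by rewrite mulmxA commYi -mulmxA -/(u k) -[in u k](prednK k_gt0) mulYiu.
elim: i => // -[_ _|i IHi lt_ik].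
  by rewrite /= -scalemxAr YkYi !big_geq // !scaler0 subr0 addr0 subn1.
rewrite [xc _]/= -/(xc i.+1) mulmxDr mulmxBr -!scalemxAr YkYi.
rewrite mulmxA commYi -mulmxA IHi; last by lia.
rewrite vbas_u 1?mulYnu; last by lia.
rewrite !(big_nat_recr i.+1 1) //=.
rewrite mulmxDr mulmxBr -!scalemxAr !mulmx_sumr.
have uS n m : n = m.+1 -> Yi *m u n = u m by move=> ->; exact: mulYiu.
rewrite (uS (k - i.+1)%N (k - i.+2)%N); last by lia.
have -> : \sum_(1 <= j < i.+1) Yi *m u (k + 2 * j - i.+1)%N
  = \sum_(1 <= j < i.+1) u (k + 2 * j - i.+2)%N.
  by apply: eq_big_nat => j lt_j; apply: uS; lia.
have -> : \sum_(1 <= j < i.+1) Yi *m (A j *: u (k + j - i.+1)%N)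
  = \sum_(1 <= j < i.+1) A j *: u (k + j - i.+2)%N.
  apply: eq_big_nat => j lt_j; rewrite -scalemxAr; congr (_ *: _).
  by apply: uS; lia.
rewrite !scalerDr scalerA.
have -> : (k + 2 * i.+1 - i.+2)%N = (k + i)%N by lia.
have -> : (k + i.+1 - i.+2)%N = k.-1 by lia.
rewrite opprD !addrA; congr (_ + _); exact: addrAC.
Qed.

Lemma sum_qcoef_Xcol : \sum_(0 <= i < k.+1) Q i *: xc i = 0.
Proof.
have YkK : invmx (Y ^+ k) *m Y ^+ k = 1%:M.
  have Yn_unit n : Y ^+ n \in unitmx; last by rewrite mulVmx.
  elim: n => [|n IHn]; first by rewrite expr0 unitmx1.
  by rewrite exprS unitmx_mul IHn Ybar_unit.
rewrite -[LHS]mul1mx -YkK -mulmxA -[RHS](mulmx0 _ (invmx (Y ^+ k))).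
congr (_ *m _); rewrite mulmx_sumr big_ltn //.
rewrite -[RHS](admissible_sum _ _ _ _ _ _ _ _ k_gt0 q0_unit u_rec adm).
congr (_ + _).
  by rewrite qcoef_lt // /= scalerA -scalemxAr.
by apply: eq_big_nat => i lt_i; rewrite -scalemxAr Xcol_closed.
Qed.

(** For i = k - 1 this says that X respects the relation expressing Y^k by
    lower powers, which is sum_qcoef_Xcol. *)
Lemma XYvbas i : (i < k)%N -> X *m (Y *m v i) = xc i.+1.
Proof.
move=> lt_ik; have [lt_i1k|le_k] := ltnP i.+1 k.
  by rewrite [Y *m _]mx_of_basisE // lt_i1k mx_of_basisE.
rewrite [Y *m _]mx_of_basisE // ltnNge le_k mulmx_sumr.
have -> : i.+1 = k by apply/eqP; rewrite eqn_leq le_k lt_ik.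
have := sum_qcoef_Xcol; rewrite big_nat_recr //= qcoef_k scaleN1r.
move/eqP; rewrite subr_eq0 => /eqP <-; rewrite big_mkord.
by apply: eq_bigr => j _; rewrite -scalemxAr mx_of_basisE ?qcoef_lt.
Qed.

Lemma Wbar_vbas i : (i < k)%N ->
  W *m v i = xc i - delta *: v i + (delta * A i) *: v 0.
Proof.
move=> lt_ik; rewrite mulmxDl mulmxBl mul_scalar_mx -scalemxAl.
by rewrite !mx_of_basisE // scalerA.
Qed.

Lemma lam_weight : lam - delta + delta * A 0%N = lam^-1.
Proof. by have [lam_A0 _ _] := adm; rewrite -[RHS](subKr lam) lam_A0; ring. Qed.

Lemma Wbar_vbas0 : W *m v 0 = lam^-1 *: v 0.
Proof. by rewrite Wbar_vbas //= -scalerBl -scalerDl lam_weight. Qed.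

(** With XYvbas, this is the recursion that defines Xcol. *)
Lemma YbarXbarYbar : Y * X * Y = W.
Proof.
apply: mx_basis_ext => i lt_ik.
rewrite -[Y * X * Y]/(Y *m X *m Y) -2!mulmxA XYvbas //.
case: i lt_ik => [|i] lt_ik.
  by rewrite Wbar_vbas0 /= -scalemxAr mulKVmx // Ybar_unit.
rewrite Wbar_vbas // [xc i.+2]/= -/(xc i.+1) mulmxDr mulmxBr -!scalemxAr.
by rewrite !mulKVmx ?Ybar_unit // !vbas_u ?mulYu // ltnW.
Qed.

Let phi : 'rV[R]_k := \row_j A j.

Lemma phi_vbas i : (i < k)%N -> phi *m v i = (A i)%:M.
Proof.
move=> lt_ik; apply/rowP => j; rewrite !mxE ord1 eqxx mulr1n.
rewrite (bigD1 (Ordinal lt_ik)) //= !mxE eqxx mulr1 big1 ?addr0 // => r.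
by rewrite -val_eqE !mxE /= => /negPf ->; rewrite mulr0.
Qed.

Lemma EbarE : E = v 0 *m phi.
Proof.
apply: mx_basis_ext => i lt_ik.
by rewrite mx_of_basisE // -mulmxA phi_vbas // mul_mx_scalar.
Qed.

Lemma XbarEbar : X * E = lam *: E.
Proof.
by rewrite EbarE -[X * _]/(X *m _) mulmxA mx_of_basisE // -scalemxAl.
Qed.

Lemma lreg_col (m : nat) (a b : 'cV[R]_m) : delta *: a = delta *: b -> a = b.
Proof.
by move=> ab; apply/colP => i; move/colP/(_ i): ab; rewrite !mxE => /delta_reg.
Qed.

Lemma u_coord j m (lt_mk : (m < k)%N) : (j < k)%N ->
  u j (Ordinal lt_mk) 0 = (m == j)%:R.
Proof. by move=> lt_jk; rewrite -vbas_u // mxE. Qed.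

(** Since N v_0 = 0, moving N to the right through Y^i leaves
    N u_i = delta (c(u_1) u_(i-1) + ... + c(u_i) u_0).  The recurrence of the
    u_i is thus sent by N to delta times a triangular linear system in the
    c(u_n), with q_k = -1 on the diagonal. *)
Lemma twisted_commutator_vanish (N : 'M[R]_k) (c : 'rV[R]_k) :
  N *m Y = Y *m N + delta *: (v 0 *m c *m Y) -> N *m v 0 = 0 ->
  c *m v 0 = 0 -> c = 0.
Proof.
move=> NY Nv0 cv0; pose d j := (c *m u j) 0 0.
have cu j : c *m u j = (d j)%:M by exact: mx11_scalar.
have Nu i : N *m u i = delta *: \sum_(0 <= j < i) d j.+1 *: u (i - j.+1)%N.
  elim: i => [|i IHi]; first by rewrite big_geq // scaler0 /u expr0 mul1mx.
  rewrite -mulYu mulmxA NY mulmxDl -mulmxA IHi -scalemxAl -!mulmxA mulYu cu.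
  rewrite mul_mx_scalar -scalemxAr -scalerDr big_nat_recr //= subnn mulmx_sumr.
  congr (_ *: (_ + _ *: _)); last by rewrite /u expr0 mul1mx.
  apply: eq_big_nat => j lt_ji; rewrite -scalemxAr mulYu; congr (_ *: u _); lia.
have sumd : \sum_(0 <= i < k.+1)
    Q i *: \sum_(0 <= j < i) d j.+1 *: u (i - j.+1)%N = 0.
  apply: lreg_col; rewrite scaler0 scaler_sumr.
  transitivity (N *m \sum_(0 <= r < k.+1) Q r *: u (0 + r)%N).
    rewrite mulmx_sumr; apply: eq_bigr => i _.
    by rewrite -scalemxAr Nu !scalerA mulrC.
  by rewrite u_rec mulmx0.
have d0 n : (n <= k)%N -> d n = 0.
  elim/ltn_ind: n => -[|n] IHn lt_nk.
    by rewrite /d /u expr0 mul1mx cv0 mxE.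
  (* In the coordinate k - n - 1 of sumd, the summand i = k contributes
     q_k d_(n+1), and the others involve only d_j with j <= n. *)
  have lt_mk : (k - n.+1 < k)%N by lia.
  have /colP/(_ (Ordinal lt_mk)) := sumd; rewrite mxE summxE.
  rewrite big_nat_recr //= big_nat big1 ?add0r => [|i /andP[_ lt_ik]];
    last first.
    rewrite mxE summxE big_nat big1 ?mulr0 // => j /andP[_ lt_ji].
    rewrite mxE u_coord; last by lia.
    have [eq_m|] := eqVneq; last by rewrite mulr0.
    by rewrite IHn ?mul0r //; lia.
  rewrite mxE summxE (bigD1_seq n) ?iota_uniq ?mem_index_iota //=.
  rewrite mxE u_coord ?eqxx ?mulr1; last by lia.
  rewrite big_seq_cond big1 ?addr0 ?qcoef_k ?mulN1r => [/eqP|j].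
    by rewrite oppr_eq0 => /eqP.
  rewrite mem_index_iota => /andP[lt_jk /eqP ne_jn].
  rewrite mxE u_coord; last by lia.
  by case: eqP => [|_]; [lia|rewrite mulr0].
apply: trmx_inj; apply/colP => i; rewrite trmx0 [RHS]mxE mxE.
have := cu i; rewrite -vbas_u // d0 1?ltnW // => /rowP/(_ 0).
rewrite mxE (bigD1 i) //= !mxE !eqxx mulr1 mul0rn big1 ?addr0 // => r.
by rewrite -val_eqE !mxE /= => /negPf ->; rewrite mulr0.
Qed.

Lemma mulmx_vbas_eq0 (N : 'M[R]_k) : N *m Y = Y *m N -> N *m v 0 = 0 -> N = 0.
Proof.
move=> NY Nv0; apply: mx_basis_ext => i lt_ik; rewrite mul0mx vbas_u //.
elim: i {lt_ik} => [|i IHi]; first by rewrite /u expr0 mul1mx.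
by rewrite -mulYu mulmxA NY -mulmxA IHi mulmx0.
Qed.

(** The two identities are proved together: the defect c of the first one is the
    obstruction for the defect N of the second one to commute with Y. *)
Lemma Ebar_Xbar_and_Xbar_Wbar : E * X = lam *: E /\ X * W = 1.
Proof.
pose c := lam *: phi - phi *m X; pose N := X *m W - 1%:M.
have Ec : lam *: E - E *m X = v 0 *m c.
  by rewrite mulmxBr -scalemxAr mulmxA EbarE.
have WX : W *m X = X *m W - delta *: (v 0 *m c).
  rewrite -Ec -XbarEbar -[X * E]/(X *m E) /Wbar !mulmxDl !mulmxDr mulNmx mulmxN.
  rewrite mul_scalar_mx mul_mx_scalar -scalemxAl -scalemxAr scalerBr.
  by rewrite opprB [RHS]addrC [RHS]addrCA subrK.
have Nv0 : N *m v 0 = 0.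
  rewrite mulmxBl -mulmxA Wbar_vbas0 -scalemxAr mx_of_basisE //.
  by rewrite /= scalerA mulVr // scale1r mul1mx subrr.
have NY : N *m Y = Y *m N + delta *: (v 0 *m c *m Y).
  have WXY : W *m X *m Y = Y *m (X *m W).
    by rewrite -YbarXbarYbar !mulmxA -[Y * X * Y]/(Y *m X *m Y).
  rewrite mulmxBl mulmxBr mul1mx mulmx1 -WXY WX mulmxBl -scalemxAl addrAC.
  by rewrite subrK.
have c0 : c = 0.
  apply: (twisted_commutator_vanish _ _ NY Nv0).
  rewrite mulmxBl -scalemxAl -mulmxA mx_of_basisE //.
  by rewrite /= -scalemxAr subrr.
split.
  apply/esym/eqP; rewrite -subr_eq0 -[E * X]/(E *m X) Ec c0 mulmx0; exact: eqxx.
apply/eqP; rewrite -subr_eq0; apply/eqP; apply: mulmx_vbas_eq0 Nv0.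
by rewrite NY c0 mulmx0 mul0mx scaler0 addr0.
Qed.

Lemma Wbar_mul_Xbar : W * X = 1.
Proof. by apply: mulmx1C; apply: Ebar_Xbar_and_Xbar_Wbar.2. Qed.

Lemma braid_relation : Y * X * Y * X = X * Y * X * Y.
Proof.
have [_ XW] := Ebar_Xbar_and_Xbar_Wbar.
by rewrite YbarXbarYbar Wbar_mul_Xbar -XW -YbarXbarYbar !mulrA.
Qed.

Lemma Ebar_Ypow_Ebar m : (m < k)%N -> E * Y ^+ m * E = A m *: E.
Proof.
move=> lt_mk; rewrite -mulrA {2 3}EbarE -[E * _]/(E *m (_ *m _)).
rewrite (mulmxA (Y ^+ m)) -/(u m) -vbas_u // mulmxA mx_of_basisE //.
by rewrite scalemxAl.
Qed.

Lemma Ebar_YbarXbarYbar : E * Y * X * Y = lam^-1 *: E.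
Proof.
have [EX _] := Ebar_Xbar_and_Xbar_Wbar.
have := Ebar_Ypow_Ebar 0 k_gt0; rewrite expr0 mulr1 => EE.
rewrite -!mulrA [Y * _]mulrA YbarXbarYbar /Wbar mulrDr mulrBr EX.
rewrite -[E * _%:M]/(E *m _) -[E * (_ *: _)]/(E *m _) mul_mx_scalar -scalemxAr.
by rewrite -[E *m E]/(E * E) EE scalerA -scalerBl -scalerDl lam_weight.
Qed.

Lemma YbarXbarYbar_Ebar : Y * X * Y * E = lam^-1 *: E.
Proof.
by rewrite YbarXbarYbar EbarE -[W * _]/(W *m _) mulmxA Wbar_vbas0 -scalemxAl.
Qed.

End Representation.

Theorem lemma3p4 (R : comUnitRingType) (k : nat) (A qs : nat -> R) (q lam : R)
    (k_gt0 : (0 < k)%N)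
    (q0_unit : qs 0%N \is a GRing.unit)
    (q_unit : q \is a GRing.unit)
    (lam_unit : lam \is a GRing.unit)
    (lam_A0 : lam - lam^-1 = (q - q^-1) * (1 - A 0%N))
    (delta_reg : GRing.lreg (q - q^-1))
    (adm : admissible k A qs q lam) :
  let Y := Ybar k qs in
  let X := Xbar k A qs q lam in
  let E := Ebar k A in
  let W := Wbar k A qs q lam in
  [/\ \sum_(l < k.+1) qcoef k qs l *: Y ^+ l = 0,
      X * W = 1 /\ W * X = 1,
      X * E = lam *: E /\ E * X = lam *: E,
      Y * X * Y * X = X * Y * X * Y
    & forall m : nat, (m < k)%N -> E * Y ^+ m * E = A m *: E]
  /\ (E * Y * X * Y = lam^-1 *: E /\ Y * X * Y * E = lam^-1 *: E)
  /\ (exists2 act : bmw2 k A qs q lam -> 'cV[R]_k -> 'cV[R]_k,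
      is_left_module act &
      [/\ forall (c : R) (v : 'cV[R]_k),
            act (c *: (1 : bmw2 k A qs q lam)) v = c *: v,
          forall v : 'cV[R]_k, act (bmwY k A qs q lam) v = Y *m v,
          forall v : 'cV[R]_k, act (bmwX k A qs q lam) v = X *m v,
          forall v : 'cV[R]_k, act (bmwXi k A qs q lam) v = W *m v
        & forall v : 'cV[R]_k, act (bmwE k A qs q lam) v = E *m v]).
Proof.
move=> Y X E W.
have polyY : \sum_(l < k.+1) qcoef k qs l *: Y ^+ l = 0 by apply: Ybar_poly.
have [EX XW] : E * X = lam *: E /\ X * W = 1 by apply: Ebar_Xbar_and_Xbar_Wbar.
have WX : W * X = 1 by apply: Wbar_mul_Xbar.
have XE : X * E = lam *: E by apply: XbarEbar.
have YXYX : Y * X * Y * X = X * Y * X * Y by apply: braid_relation.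
have EYE m : (m < k)%N -> E * Y ^+ m * E = A m *: E by apply: Ebar_Ypow_Ebar.
have EYXY : E * Y * X * Y = lam^-1 *: E by apply: Ebar_YbarXbarYbar.
have YXYE : Y * X * Y * E = lam^-1 *: E by apply: YbarXbarYbar_Ebar.
split; first by [].
split; first by [].
have Y_unit : Y \in unitmx by apply: Ybar_unit.
have polyYk : Y ^+ k = \sum_(i < k) qs i *: Y ^+ i.
  move: polyY; rewrite big_ord_recr /= qcoef_k scaleN1r => /eqP.
  rewrite subr_eq0 => /eqP <-; by apply: eq_bigr => i _; rewrite qcoef_lt.
have skein : X - W = (q - q^-1) *: (1 - E).
  by rewrite /W /Wbar -scalemx1 scalerBr opprD opprB addrA addrCA subrr addr0.
(* Matrices of size n + 1 form a nonzero algebra over R, as required of the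
   target of the evaluation. *)
case: k k_gt0 @Y @X @E @W {adm} polyY EX XW WX XE YXYX EYE EYXY YXYE Y_unit
  polyYk skein => // n _ Y X E W *.
by apply: bmw2_matrix_module => //; [exact: mulmxV|exact: mulVmx].
Qed.
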